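(* Let $L$ be a positive-definite even lattice, $M\le L$ a submonoid, and $S\subset L$ a sub-semigroup. Then: (1) $\big(V_M:=\bigoplus_{\alpha\in M}M_{\hat{\mathfrak{h}}}(1,\alpha),Y,\omega,\mathbf{1}\big)$ is a CFT-type subVOA of $(V_L,Y,\omega,\mathbf{1})$. (2) $\big(V_S:=\bigoplus_{\alpha\in S}M_{\hat{\mathfrak{h}}}(1,\alpha),Y,L(-1)\big)$ is a sub-vertex algebra without vacuum of $(V_L,Y,L(-1))$. If, furthermore, $S\subset M$ and $M+S\subseteq S$, then $V_S$ is an ideal of $V_M$.
   Context: A submonoid of $L$ is a subset containing $0$ and closed under addition; a sub-semigroup of $L$ is a subset closed under addition. Lattice VOA. For a positive-definite even lattice $L$ of rank $d\ge1$ (form $(\cdot|\cdot)$ integer valued, $(\alpha|\alpha)\in 2\mathbb{Z}$) put $\mathfrak{h}=\mathbb{C}\otimes_{\mathbb{Z}}L$ with the $\mathbb{C}$-bilinear extension of $(\cdot|\cdot)$, and $\hat{\mathfrak{h}}=\mathfrak{h}\otimes\mathbb{C}[t,t^{-1}]\oplus\mathbb{C}K$ with $K$ central, $h(m)=h\otimes t^m$, $[h_1(m),h_2(n)]=m\delta_{m+n,0}(h_1|h_2)K$. For $\lambda\in\mathfrak{h}$, $M_{\hat{\mathfrak{h}}}(1,\lambda)=U(\hat{\mathfrak{h}})\otimes_{U(\hat{\mathfrak{h}}_{\ge 0})}\mathbb{C}e^\lambda$, where $\hat{\mathfrak{h}}_{\ge 0}=\mathfrak{h}\otimes\mathbb{C}[t]\oplus\mathbb{C}K$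 acts by $K=1$, $h(0)e^\lambda=(h|\lambda)e^\lambda$, $h(n)e^\lambda=0$ for $n>0$. Let $\epsilon:L\times L\to\{\pm1\}$ be a 2-cocycle with $\epsilon(\alpha,\beta)\epsilon(\beta,\alpha)=(-1)^{(\alpha|\beta)}$ and $\epsilon(0,\alpha)=\epsilon(\alpha,0)=1$. The lattice VOA is $V_L=\bigoplus_{\alpha\in L}M_{\hat{\mathfrak{h}}}(1,\alpha)=M_{\hat{\mathfrak{h}}}(1,0)\otimes\mathbb{C}^\epsilon[L]$ with vacuum $\mathbf{1}=e^0$, $Y(h(-1)\mathbf{1},z)=\sum_{n}h(n)z^{-n-1}$, $Y(e^\alpha,z)=\exp\big(\sum_{n>0}\frac{\alpha(-n)}{n}z^n\big)\exp\big(-\sum_{n>0}\frac{\alpha(n)}{n}z^{-n}\big)e_\alpha z^\alpha$, where $e_\alpha(w\otimes e^\beta)=\epsilon(\alpha,\beta)w\otimes e^{\alpha+\beta}$ and $z^\alpha$ acts on $M_{\hat{\mathfrak{h}}}(1,\beta)$ as $z^{(\alpha|\beta)}$; $Y$ of a general $h_1(-n_1-1)\cdots h_k(-n_k-1)e^\alpha$ is the normally ordered product of the $\frac{1}{n_i!}\partial_z^{n_i}h_i(z)$ and $Y(e^\alpha,z)$. The Virasoro element is $\omega=\frac12\sum_i u_i(-1)^2\mathbf{1}$ for an orthonormal basis $\{u_i\}$ of $\mathfrak{h}$, $Y(\omega,z)=\sum_n L(n)z^{-n-2}$; the weight of $h_1(-n_1)\cdots h_k(-n_k)e^\alpha$ is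 $n_1+\cdots+n_k+(\alpha|\alpha)/2$. A VOA $V$ is of CFT-type if $V=V_0\oplus V_+$ with $V_0=\mathbb{C}\mathbf{1}$, $V_+=\bigoplus_{n\ge1}V_n$. A vertex algebra without vacuum is a triple $(V,Y,D)$ with $V$ a vector space, $Y:V\to\mathrm{End}(V)[[z,z^{-1}]]$, $a\mapsto Y(a,z)=\sum_n a_nz^{-n-1}$, and $D:V\to V$ linear, satisfying: truncation ($a_nb=0$ for $n\gg0$), $[D,Y(a,z)]=\frac{d}{dz}Y(a,z)$, skew-symmetry $Y(a,z)b=e^{zD}Y(b,-z)a$, and the Jacobi identity. A VOA is one with $D=L(-1)$. A sub-vertex algebra without vacuum of $V$ is a subspace closed under $Y$ (all products $a_nb$, $n\in\mathbb{Z}$) and $L(-1)$. *)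

(* Defs.v *)
From HB Require Import structures.
From mathcomp Require Import all_boot all_order all_algebra.
From mathcomp Require Import finmap multiset.
From mathcomp Require Import monalg.
From mathcomp Require Import boolp classical_sets fsbigop reals.
From mathcomp Require Import complex ring.

Set Implicit Arguments.
Unset Strict Implicit.
Unset Printing Implicit Defensive.

Import Order.TTheory GRing.Theory Num.Theory.

Local Open Scope ring_scope.
Local Open Scope complex_scope.

(* ------------------------------------------------------------------------ *)
(* Vertex (operator) algebras: data and substructures                       *)
(* ------------------------------------------------------------------------ *)

(* [va_Y a n b] is the product a_n b, i.e. Y(a,z) = \sum_n a_n z^(-n-1). *)
Record vertexData (F : fieldType) := VertexData {
  va_space :> lmodType F;
  va_Y : va_space -> int -> va_space -> va_space;
  va_vac : va_space;
  va_omega : va_space }.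

Section VertexAlgebras.
Variables (F : fieldType) (V : vertexData F).
Implicit Types (U W I : set V) (a b v : V) (n : int).

(* L(n), from Y(omega,z) = \sum_n L(n) z^(-n-2). *)
Definition Vir n v : V := va_Y (va_omega V) (n + 1) v.

Definition subspace W :=
  W 0 /\ forall (c : F) a b, W a -> W b -> W (c *: a + b).

Definition closedY W := forall a b n, W a -> W b -> W (va_Y a n b).

Definition subVA_without_vacuum W :=
  [/\ subspace W, closedY W & forall a, W a -> W (Vir (- 1) a)].

(* The axioms of a VOA other than those below and the grading are identities
   and finiteness conditions, which W inherits from V. *)
Definition subVOA W :=
  [/\ subspace W, closedY W, W (va_vac V) & W (va_omega V)].

(* The weight spaces are the eigenspaces of L(0). *)
Definition weight_space W n : set V :=
  [set v | W v /\ Vir 0 v = n%:~R *: v]%classic.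

(* W = W_0 (+) W_1 (+) W_2 (+) ..., with W_0 spanned by the vacuum. *)
Definition CFT_type W :=
  [/\ (forall v, W v -> exists (N : nat) (x : nat -> V),
         (forall n : nat, weight_space W n%:Z (x n)) /\ v = \sum_(n < N) x n),
      (forall (N : nat) (x : nat -> V),
         (forall n : nat, weight_space W n%:Z (x n)) -> \sum_(n < N) x n = 0 ->
         forall n : 'I_N, x n = 0)
    & forall v, weight_space W 0 v <-> exists c : F, v = c *: va_vac V].

Definition ideal_of W I :=
  [/\ subspace I, (I `<=` W)%classic,
      (forall a b n, W a -> I b -> I (va_Y a n b) /\ I (va_Y b n a))
    & forall b, I b -> I (Vir (- 1) b)].

End VertexAlgebras.

(* ------------------------------------------------------------------------ *)
(* Formal calculus with operator coefficients                               *)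
(* ------------------------------------------------------------------------ *)

Section FormalCalculus.
Variables (F : fieldType) (V : lmodType F).

(* Sum of a locally finite family: only finitely many terms are nonzero in
   every use below. *)
Definition lfsum (f : nat -> V) : V :=
  (\sum_(j \in [set: nat]%classic) f j)%R.

(* [f k] is the coefficient of the k-th power of the formal variable. *)
Definition opseries := nat -> V -> V.

Definition opseries1 : opseries := fun k v => if k == 0%N then v else 0.

Definition opseries_mul (f g : opseries) : opseries :=
  fun k v => \sum_(i < k.+1) f i (g (k - i)%N v).

(* exp f for a series f without constant term: f^m does not contribute to the
   k-th coefficient when m > k. *)
Definition opseries_exp (f : opseries) : opseries :=
  fun k v => \sum_(m < k.+1)
    (m`!%:R)^-1 *: iter m (opseries_mul f) opseries1 k v.

(* [A n] is the coefficient of z^(-n-1). *)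
Definition field_op := int -> V -> V.

Definition field_deriv (A : field_op) : field_op :=
  fun n v => (- n)%:~R *: A (n - 1) v.

(* (1/m!) (d/dz)^m *)
Definition field_dpow (m : nat) (A : field_op) : field_op :=
  fun n v => (m`!%:R)^-1 *: iter m field_deriv A n v.

(* :A(z)B(z): = (\sum_(j<0) A_j z^(-j-1)) B(z) + B(z) (\sum_(j>=0) A_j z^(-j-1))
 *)
Definition nop (A B : field_op) : field_op := fun n v =>
  lfsum (fun j => A (- j%:Z - 1) (B (n + j%:Z) v)) +
  lfsum (fun j => B (n - j%:Z - 1) (A j%:Z v)).

End FormalCalculus.

(* ------------------------------------------------------------------------ *)
(* Even lattices                                                            *)
(* ------------------------------------------------------------------------ *)

(* A free Z-module of finite rank, presented with a Z-basis and the coordinates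
   in it, with a positive-definite even form. *)
Record evenLattice := EvenLattice {
  lat :> zmodType;
  lat_rank : nat;
  lat_basis : 'I_lat_rank -> lat;
  lat_coord : lat -> 'I_lat_rank -> int;
  lat_basisP : forall (a : lat) (x : 'I_lat_rank -> int),
    a = \sum_i lat_basis i *~ x i <-> lat_coord a =1 x;
  lat_form : lat -> lat -> int;
  lat_rank_gt0 : (0 < lat_rank)%N;
  lat_formD : forall a b c, lat_form (a + b) c = lat_form a c + lat_form b c;
  lat_formC : forall a b, lat_form a b = lat_form b a;
  lat_form_even : forall a, (2 %| lat_form a a)%Z;
  lat_form_gt0 : forall a, a != 0 -> 0 < lat_form a a }.

Definition submonoid (L : evenLattice) (M : set L) :=
  M 0 /\ forall a b, M a -> M b -> M (a + b).

Definition subsemigroup (L : evenLattice) (S : set L) :=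
  forall a b, S a -> S b -> S (a + b).

Definition lattice_cocycle (L : evenLattice) (eps : L -> L -> int) :=
  [/\ (forall a b, eps a b = 1 \/ eps a b = -1),
      (forall a b c, eps a b * eps (a + b) c = eps b c * eps a (b + c)),
      (forall a b, eps a b * eps b a = (-1) ^+ `|lat_form a b|%N)
    & forall a, eps 0 a = 1 /\ eps a 0 = 1].

(* ------------------------------------------------------------------------ *)
(* The lattice vertex operator algebra                                      *)
(* ------------------------------------------------------------------------ *)

Section LatticeVOA.
Variables (F : fieldType) (L : evenLattice).

Let d := lat_rank L.

(* h = F (x) L, in coordinates with respect to the basis
   b_i = 1 (x) lat_basis i *)
Definition cartan := 'rV[F]_d.

Definition lat_inj (a : L) : cartan := \row_i (lat_coord a i)%:~R.

Definition cartan_form (h k : cartan) : F :=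
  \sum_i \sum_j h 0 i * k 0 j * (lat_form (lat_basis i) (lat_basis j))%:~R.

(* lat_rank L orthonormal vectors are automatically a basis. *)
Definition orthonormal_basis (u : 'I_d -> cartan) :=
  forall i j, cartan_form (u i) (u j) = (i == j)%:R.

(* (i, n) stands for b_i(-n-1). *)
Definition creator : choiceType := ('I_d * nat)%type.

(* (a, [mset (i_1, n_1); ...; (i_k, n_k)]) stands for the PBW basis vector
   b_(i_1)(-n_1-1) ... b_(i_k)(-n_k-1) e^a of M(1,a); see [fock_universal]. *)
Definition fockIdx : choiceType := (L * {mset creator}%mset)%type.

(* the direct sum of the M(1,a), a in L *)
Definition fock := {malg F[fockIdx]}.

Definition lin_ext (W : lmodType F) (f : fockIdx -> W) (v : fock) : W :=
  \sum_(k <- msupp v) v@_k *: f k.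

Definition evec (a : L) : fock := << (a, mset0) >>.

(* h(-n-1) *)
Definition heis_create (h : cartan) (n : nat) : fock -> fock :=
  lin_ext (fun k => \sum_i h 0 i *: << (k.1, ((i, n) : creator) +` k.2)%mset >>).

(* h(n+1) acts as the derivation b_i(-n-1) |-> (n+1) (h|b_i) *)
Definition heis_annihilate (h : cartan) (n : nat) : fock -> fock :=
  lin_ext (fun k => \sum_i
    (((k.2 ((i, n) : creator)) * n.+1)%:R * cartan_form h (delta_mx 0 i)) *:
    << (k.1, k.2 `\ ((i, n) : creator))%mset >>).

Definition heis_zero (h : cartan) : fock -> fock :=
  lin_ext (fun k => cartan_form h (lat_inj k.1) *: << k >>).

(* h(m); also the coefficients of the field h(z) *)
Definition heis (h : cartan) : field_op fock := fun m =>
  match m with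
  | Posz 0 => heis_zero h
  | Posz n.+1 => heis_annihilate h n
  | Negz n => heis_create h n
  end.

(* M(1,a) summed over the a in A *)
Definition fock_sub (A : set L) : set fock :=
  [set v | forall k, k \in msupp v -> A k.1]%classic.

Variable eps : L -> L -> int.

Definition twist (a : L) : fock -> fock :=
  lin_ext (fun k => (eps a k.1)%:~R *: << (a + k.1, k.2) >>).

(* exp(\sum_(n>0) a(-n)/n z^n), in powers of z *)
Definition expminus (a : L) : opseries fock :=
  opseries_exp (fun n v =>
    if n == 0%N then 0 else n%:R^-1 *: heis (lat_inj a) (- n%:Z) v).

(* exp(- \sum_(n>0) a(n)/n z^(-n)), in powers of z^-1 *)
Definition expplus (a : L) : opseries fock :=
  opseries_exp (fun n v =>
    if n == 0%N then 0 else - (n%:R^-1 *: heis (lat_inj a) n%:Z v)).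

(* coefficient of z^p in the product of the two exponentials *)
Definition expprod (a : L) (p : int) (v : fock) : fock :=
  lfsum (fun j => if p + j%:Z is Posz i then expminus a i (expplus a j v)
                  else 0).

(* Y(e^a,z): as z^a is z^(a|b) on M(1,b), the coefficient of z^(-n-1) comes
   from the coefficient of z^(-n-1-(a|b)) in the exponentials. *)
Definition Yexp (a : L) : field_op fock := fun n =>
  lin_ext (fun k => expprod a (- n - 1 - lat_form a k.1) (twist a << k >>)).

(* Y(b_(i_1)(-n_1-1) ... b_(i_k)(-n_k-1) e^a, z); the normally ordered product
   does not depend on the order in which the multiset is enumerated. *)
Definition Ybasis (k : fockIdx) : field_op fock :=
  foldr (fun (x : creator) (B : field_op fock) =>
           nop (field_dpow x.2 (heis (delta_mx 0 x.1))) B)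
        (Yexp k.1) (enum_mset k.2).

Definition lattice_Y (v : fock) (n : int) (w : fock) : fock :=
  lin_ext (fun k => Ybasis k n w) v.

Definition lattice_omega (u : 'I_d -> cartan) : fock :=
  2%:R^-1 *: \sum_i heis (u i) (- 1) (heis (u i) (- 1) (evec 0)).

Definition latticeVOA (u : 'I_d -> cartan) : vertexData F :=
  @VertexData F fock lattice_Y (evec 0) (lattice_omega u).

End LatticeVOA.

(* ------------------------------------------------------------------------ *)
(* [fock] with the operators [heis] is the direct sum over a in L of the    *)
(* induced modules U(h^) (x)_(U(h^_(>=0))) F e^a                            *)
(* ------------------------------------------------------------------------ *)

Section InducedModules.
Variables (F : fieldType) (L : evenLattice).

Local Notation d := (lat_rank L).
Local Notation fock := (fock F L).
Local Notation fockIdx := (fockIdx L).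
Local Notation creator := (creator L).
Local Notation cartan := (cartan F L).

Lemma lin_extE (W : lmodType F) (f : fockIdx -> W) (D : {fset fockIdx})
    (v : fock) :
  (msupp v `<=` D)%fset -> lin_ext f v = \sum_(k <- D) v@_k *: f k.
Proof.
move=> sD; rewrite /lin_ext (big_fset_incl _ sD)// => k _ kv.
by rewrite mcoeff_outdom// scale0r.
Qed.

Lemma lin_ext_linear (W : lmodType F) (f : fockIdx -> W) :
  linear (lin_ext f : fock -> W).
Proof.
move=> c v w.
pose D := (msupp v `|` (msupp w `|` msupp (c *: v + w)))%fset.
have sv : (msupp v `<=` D)%fset by apply: fsubsetUl.
have sw : (msupp w `<=` D)%fset by rewrite /D fsetUCA fsubsetUl.
have svw : (msupp (c *: v + w) `<=` D)%fset by rewrite /D fsetUA fsubsetUr.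
rewrite (lin_extE f sv) (lin_extE f sw) (lin_extE f svw).
rewrite scaler_sumr -big_split/=; apply: eq_bigr => k _.
by rewrite mcoeffD mcoeffZ scalerDl scalerA.
Qed.

Lemma lin_extU (W : lmodType F) (f : fockIdx -> W) k :
  lin_ext f (<< k >> : fock) = f k.
Proof.
by rewrite (lin_extE f msuppU_le) big_seq_fset1 mcoeffUU scale1r.
Qed.

Lemma fock_lin_eq (W : lmodType F) (f g : fock -> W) :
  linear f -> linear g -> (forall k, f << k >> = g << k >>) -> f =1 g.
Proof.
move=> lf lg fg v.
pose f' : {linear fock -> W} := HB.pack f (GRing.isLinear.Build F fock W *:%R f lf).
pose g' : {linear fock -> W} := HB.pack g (GRing.isLinear.Build F fock W *:%R g lg).
rewrite -[f v]/(f' v) -[g v]/(g' v) [v]monalgE !linear_sum.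
apply: eq_bigr => k _.
have -> : << v@_k *g k >> = v@_k *: << k >> :> fock.
  by apply/malgP => k'; rewrite mcoeffZ !mcoeffU mulrnAr mulr1.
by rewrite !linearZ /= fg.
Qed.

(* A level-one representation of the Heisenberg algebra, [rho h m] being the
   action of h(m). *)
Definition heis_rep (N : lmodType F) (rho : cartan -> field_op N) :=
  [/\ (forall m v, linear (fun h => rho h m v)),
      (forall h m, linear (rho h m))
    & forall h k m n v, rho h m (rho k n v) - rho k n (rho h m v) =
        (m%:~R * (m + n == 0)%:R * cartan_form h k) *: v].

Definition heis_hw (N : lmodType F) (rho : cartan -> field_op N)
    (a : cartan) (w : N) :=
  (forall h, rho h 0 w = cartan_form h a *: w) /\
  (forall h n, rho h n.+1%:Z w = 0).

Lemma cartan_formDl c (h h' k : cartan) :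
  cartan_form (c *: h + h') k = c * cartan_form h k + cartan_form h' k.
Proof.
rewrite /cartan_form mulr_sumr -big_split; apply: eq_bigr => i _ /=.
rewrite mulr_sumr -big_split; apply: eq_bigr => j _ /=.
by rewrite !mxE !mulrDl !mulrA.
Qed.

Lemma cartan_formC (h k : cartan) : cartan_form h k = cartan_form k h.
Proof.
rewrite /cartan_form exchange_big; apply: eq_bigr => i _; apply: eq_bigr => j _.
by rewrite lat_formC [h 0 _ * _]mulrC.
Qed.

Lemma cartan_form_basis (h k : cartan) :
  cartan_form h k = \sum_i k 0 i * cartan_form h (delta_mx 0 i).
Proof.
rewrite cartan_formC /cartan_form; apply: eq_bigr => i _.
rewrite mulr_sumr; apply: eq_bigr => j _.
rewrite (bigD1 i)//= [X in _ + X]big1 ?addr0; last first.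
  by move=> l li; rewrite mxE (negPf li) andbF mulr0 mul0r.
by rewrite mxE !eqxx mulr1 mulrA lat_formC.
Qed.

Lemma create_U (h : cartan) n a (m : {mset creator}%mset) :
  heis_create h n (<< (a, m) >> : fock) =
  \sum_i h 0 i *: << (a, (((i, n) : creator) +` m)%mset) >>.
Proof. exact: lin_extU. Qed.

Lemma annihilate_U (h : cartan) n a (m : {mset creator}%mset) :
  heis_annihilate h n (<< (a, m) >> : fock) =
  \sum_i ((m ((i, n) : creator) * n.+1)%:R * cartan_form h (delta_mx 0 i)) *:
    << (a, (m `\ ((i, n) : creator))%mset) >>.
Proof. exact: lin_extU. Qed.

Lemma zero_U (h : cartan) a (m : {mset creator}%mset) :
  heis_zero h (<< (a, m) >> : fock) = cartan_form h (lat_inj F a) *: << (a, m) >>.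
Proof. exact: lin_extU. Qed.

Lemma heis_linear (h : cartan) m : linear (heis h m : fock -> fock).
Proof. by case: m => [[|n]|n]; apply: lin_ext_linear. Qed.

Lemma lin_ext_fun_linear (W : lmodType F) (f g h : fockIdx -> W) c (v : fock) :
  (forall k, h k = c *: f k + g k) ->
  lin_ext h v = c *: lin_ext f v + lin_ext g v.
Proof.
move=> e; rewrite /lin_ext scaler_sumr -big_split; apply: eq_bigr => k _ /=.
by rewrite e scalerDr !scalerA mulrC.
Qed.

Lemma sum_linear (W : lmodType F) (I : finType) (f g h : I -> F) c (w : I -> W) :
  (forall i, h i = c * f i + g i) ->
  \sum_i h i *: w i = c *: (\sum_i f i *: w i) + \sum_i g i *: w i.
Proof.
move=> e; rewrite scaler_sumr -big_split; apply: eq_bigr => i _ /=.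
by rewrite e scalerDl scalerA.
Qed.

Lemma heis_linearl m (v : fock) : linear (fun h : cartan => heis h m v).
Proof.
move=> c h k; case: m => [[|n]|n] /=; apply: lin_ext_fun_linear => l.
- by rewrite cartan_formDl scalerDl scalerA.
- apply: sum_linear => i; rewrite cartan_formDl mulrDr; congr (_ + _).
  by rewrite mulrCA.
- by apply: sum_linear => i; rewrite !mxE.
Qed.

Lemma lin_sum2 (V W : lmodType F) (I J : finType) (f : V -> W) (c : I -> F)
    (w : I -> V) (e : I -> J -> F) (w' : I -> J -> W) :
  linear f -> (forall i, f (w i) = \sum_j e i j *: w' i j) ->
  f (\sum_i c i *: w i) = \sum_i \sum_j (c i * e i j) *: w' i j.
Proof.
move=> lf fw.
pose f' : {linear V -> W} := HB.pack f (GRing.isLinear.Build F V W *:%R f lf).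
rewrite -[f _]/(f' _) linear_sum; apply: eq_bigr => i _.
rewrite linearZ/= fw scaler_sumr; apply: eq_bigr => j _.
exact: scalerA.
Qed.

Lemma sum_split (V : nmodType) (I : finType) (f g h : I -> V) :
  (forall i, f i = g i + h i) -> \sum_i f i = \sum_i g i + \sum_i h i.
Proof. by move=> e; rewrite -big_split; apply: eq_bigr. Qed.

Lemma sum_single (V : nmodType) (I : finType) (f : I -> V) j :
  (forall i, i != j -> f i = 0) -> \sum_i f i = f j.
Proof. by move=> f0; rewrite (bigD1 j)//= big1 ?addr0. Qed.

Lemma lin_comp (U V W : lmodType F) (f : V -> W) (g : U -> V) :
  linear f -> linear g -> linear (fun v => f (g v)).
Proof. by move=> lf lg c a b; rewrite lg lf. Qed.

Lemma lin_add (V W : lmodType F) (f g : V -> W) :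
  linear f -> linear g -> linear (fun v => f v + g v).
Proof. by move=> lf lg c a b; rewrite lf lg scalerDr addrACA. Qed.

Lemma lin_scale (V : lmodType F) (c : F) : linear (fun v : V => c *: v).
Proof. by move=> e a b; rewrite scalerDr !scalerA mulrC. Qed.

Lemma mset_swap_del (m : {mset creator}%mset) x y :
  ((m `\ x) `\ y)%mset = ((m `\ y) `\ x)%mset.
Proof. by apply/msetP => z; rewrite !msetB1E subnAC. Qed.

Lemma create_linear (h : cartan) n : linear (heis_create h n : fock -> fock).
Proof. exact: lin_ext_linear. Qed.

Lemma annihilate_linear (h : cartan) n :
  linear (heis_annihilate h n : fock -> fock).
Proof. exact: lin_ext_linear. Qed.

Lemma zero_linear (h : cartan) : linear (heis_zero h : fock -> fock).
Proof. exact: lin_ext_linear. Qed.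

Lemma create_create (h k : cartan) p q (v : fock) :
  heis_create h p (heis_create k q v) = heis_create k q (heis_create h p v).
Proof.
move: v; apply: (fock_lin_eq (lin_comp (create_linear h p) (create_linear k q))
  (lin_comp (create_linear k q) (create_linear h p))) => -[a m]; cbv beta.
rewrite !create_U.
rewrite (lin_sum2 _ (create_linear h p) (fun i => create_U h p a (((i, q) : creator) +` m)%mset)).
rewrite (lin_sum2 _ (create_linear k q) (fun i => create_U k q a (((i, p) : creator) +` m)%mset)).
rewrite [LHS]exchange_big.
apply: eq_bigr => i _.
apply: eq_bigr => j _.
rewrite [X in X *: _]mulrC.
by rewrite msetDCA.
Qed.

Lemma annihilate_annihilate (h k : cartan) p q (v : fock) :
  heis_annihilate h p (heis_annihilate k q v) =
  heis_annihilate k q (heis_annihilate h p v).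
Proof.
move: v; apply: (fock_lin_eq
  (lin_comp (annihilate_linear h p) (annihilate_linear k q))
  (lin_comp (annihilate_linear k q) (annihilate_linear h p))) => -[a m]; cbv beta.
rewrite !annihilate_U.
rewrite (lin_sum2 _ (annihilate_linear h p) (fun i => annihilate_U h p a (m `\ ((i, q) : creator))%mset)).
rewrite (lin_sum2 _ (annihilate_linear k q) (fun i => annihilate_U k q a (m `\ ((i, p) : creator))%mset)).
rewrite [LHS]exchange_big.
apply: eq_bigr => i _.
apply: eq_bigr => j _.
rewrite mset_swap_del.
congr (_ *: _).
rewrite [LHS]mulrACA [RHS]mulrACA -!natrM [cartan_form k _ * _]mulrC.
congr (_%:R * _); rewrite !msetB1E.
rewrite mulnACA [RHS]mulnACA [(q.+1 * _)%N]mulnC; congr (_ * _)%N.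
rewrite [in RHS]eq_sym; case: eqP => [->|_]; first by [].
by rewrite !subn0 mulnC.
Qed.

Lemma delete_add_term (a : L) (m : {mset creator}%mset) (x y : creator)
    (N : nat) (c e : F) :
  (c * (((y +` m)%mset x * N)%:R * e)) *: (<< (a, ((y +` m) `\ x)%mset) >> : fock)
  = ((m x * N)%:R * e * c) *: << (a, (y +` (m `\ x))%mset) >> +
    ((x == y)%:R * N%:R * (c * e)) *: << (a, m) >>.
Proof.
rewrite mset1DE; case: (eqVneq x y) => [<-|xy].
  rewrite msetD1K; have [m0|m0] := posnP (m x).
    rewrite m0 mul0n !mul0r scale0r add0r !mul1r; congr (_ *: _).
    by rewrite addn0 mul1n mulrCA.
  rewrite msetB1K -?mset_gt0// -scalerDl; congr (_ *: _).
  rewrite mulnDl mul1n natrD mul1r; ring.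
rewrite add0n !mul0r scale0r addr0 [X in X *: _]mulrC.
congr (_ *: << (a, _) >>); apply/msetP => z.
rewrite msetB1E !mset1DE msetB1E.
case: (z =P x) => [->|_]; last by rewrite !subn0.
by rewrite (negPf xy) !add0n.
Qed.

Lemma annihilate_create (h k : cartan) p q (v : fock) :
  heis_annihilate h p (heis_create k q v) =
  heis_create k q (heis_annihilate h p v) +
  ((p == q)%:R * p.+1%:R * cartan_form h k) *: v.
Proof.
move: v; apply: (fock_lin_eq
  (lin_comp (annihilate_linear h p) (create_linear k q))
  (lin_add (lin_comp (create_linear k q) (annihilate_linear h p))
     (lin_scale _))) => -[a m]; cbv beta.
rewrite create_U annihilate_U.
rewrite (lin_sum2 _ (annihilate_linear h p) (fun i => annihilate_U h p a (((i, q) : creator) +` m)%mset)).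
rewrite (lin_sum2 _ (create_linear k q) (fun i => create_U k q a (m `\ ((i, p) : creator))%mset)).
rewrite [in RHS]exchange_big.
rewrite cartan_form_basis mulr_sumr scaler_suml -big_split.
apply: eq_bigr => j _; cbv beta.
refine (etrans (sum_split (fun i => delete_add_term a m (i, p) (j, q) p.+1
  (k 0 j) (cartan_form h (delta_mx 0 i)))) _).
congr (_ + _).
rewrite (sum_single (j := j)).
  by rewrite xpair_eqE eqxx.
move=> i ij; rewrite xpair_eqE (negPf ij) !mul0r; exact: scale0r.
Qed.

Lemma cartan_decomp (h : cartan) : h = \sum_i h 0 i *: delta_mx 0 i.
Proof. exact: row_sum_delta. Qed.

Lemma create_delta (i : 'I_d) n a (m : {mset creator}%mset) :
  heis_create (delta_mx 0 i) n (<< (a, m) >> : fock) =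
  << (a, (((i, n) : creator) +` m)%mset) >>.
Proof.
rewrite create_U (sum_single (j := i)); first by rewrite mxE !eqxx scale1r.
by move=> j ji; rewrite mxE (negPf ji) andbF scale0r.
Qed.


Lemma lin_sum1 (V W : lmodType F) (I : finType) (f : V -> W) (c e : I -> F)
    (w : I -> V) (w' : I -> W) :
  linear f -> (forall i, f (w i) = e i *: w' i) ->
  f (\sum_i c i *: w i) = \sum_i (c i * e i) *: w' i.
Proof.
move=> lf fw.
pose f' : {linear V -> W} := HB.pack f (GRing.isLinear.Build F V W *:%R f lf).
rewrite -[f _]/(f' _) linear_sum; apply: eq_bigr => i _.
by rewrite linearZ/= fw scalerA.
Qed.

Lemma lin_Z (V W : lmodType F) (f : V -> W) c v : linear f -> f (c *: v) = c *: f v.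
Proof.
move=> lf.
pose f' : {linear V -> W} := HB.pack f (GRing.isLinear.Build F V W *:%R f lf).
by rewrite -[LHS]/(f' _) linearZ.
Qed.

Lemma sum_scale (V : lmodType F) (I : finType) (c e : I -> F) (w : I -> V) x :
  (forall i, c i = x * e i) -> \sum_i c i *: w i = x *: \sum_i e i *: w i.
Proof.
by move=> ce; rewrite scaler_sumr; apply: eq_bigr => i _; rewrite ce scalerA.
Qed.

Lemma zero_create (h k : cartan) n (v : fock) :
  heis_zero h (heis_create k n v) = heis_create k n (heis_zero h v).
Proof.
move: v; apply: (fock_lin_eq (lin_comp (zero_linear h) (create_linear k n))
  (lin_comp (create_linear k n) (zero_linear h))) => -[a m]; cbv beta.
rewrite zero_U (lin_Z _ _ (create_linear k n)) create_U.
rewrite (lin_sum1 _ (zero_linear h)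
  (fun i => zero_U h a (((i, n) : creator) +` m)%mset)).
by apply: sum_scale => i; rewrite mulrC.
Qed.

Lemma zero_annihilate (h k : cartan) n (v : fock) :
  heis_zero h (heis_annihilate k n v) = heis_annihilate k n (heis_zero h v).
Proof.
move: v; apply: (fock_lin_eq (lin_comp (zero_linear h) (annihilate_linear k n))
  (lin_comp (annihilate_linear k n) (zero_linear h))) => -[a m]; cbv beta.
rewrite zero_U (lin_Z _ _ (annihilate_linear k n)) annihilate_U.
rewrite (lin_sum1 _ (zero_linear h)
  (fun i => zero_U h a (m `\ ((i, n) : creator))%mset)).
by apply: sum_scale => i; rewrite mulrC.
Qed.

Lemma zero_zero (h k : cartan) (v : fock) :
  heis_zero h (heis_zero k v) = heis_zero k (heis_zero h v).
Proof.
move: v; apply: (fock_lin_eq (lin_comp (zero_linear h) (zero_linear k))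
  (lin_comp (zero_linear k) (zero_linear h))) => -[a m]; cbv beta.
rewrite !zero_U (lin_Z _ _ (zero_linear h)) (lin_Z _ _ (zero_linear k)) !zero_U.
by rewrite !scalerA [X in X *: _]mulrC.
Qed.

Lemma heis_is_rep : heis_rep (@heis F L).
Proof.
split; [exact: heis_linearl | exact: heis_linear | ].
move=> h k [[|p]|p] [[|q]|q] v.
- by rewrite [heis h 0 _]zero_zero subrr !mul0r scale0r.
- by rewrite [heis h 0 _]zero_annihilate subrr !mul0r scale0r.
- by rewrite [heis h 0 _]zero_create subrr !mul0r scale0r.
- by rewrite [X in _ - X](zero_annihilate k h p v) subrr addr0 mulr0 mul0r scale0r.
- by rewrite [heis h _ _]annihilate_annihilate subrr mulr0 mul0r scale0r.
- rewrite [heis h _ _]annihilate_create addrC addKr; congr (_ *: _).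
  rewrite [(p == q)%:R * _]mulrC NegzE subr_eq0; congr (_ * _ * _).
- by rewrite [X in _ - X](zero_create k h p v) subrr addr0 mulr0 mul0r scale0r.
- have -> : heis k q.+1 (heis h (Negz p) v) = heis h (Negz p) (heis k q.+1 v) +
      ((q == p)%:R * q.+1%:R * cartan_form k h) *: v by exact: annihilate_create.
  rewrite opprD addrA subrr add0r -scaleNr; congr (_ *: _).
  rewrite NegzE [- _ + _]addrC subr_eq0 eqz_nat eqSS cartan_formC.
  case: eqVneq => [->|_]; last by rewrite mulr0 !mul0r oppr0.
  by rewrite mul1r mulr1 mulrNz mulNr.
- by rewrite [heis h _ _]create_create subrr mulr0 mul0r scale0r.
Qed.

Lemma heis_evec a : heis_hw (@heis F L) (lat_inj F a) (evec F a).
Proof.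
split=> [h|h n]; first exact: zero_U.
rewrite [heis _ _ _]annihilate_U big1// => i _.
by rewrite mset0E mul0n mul0r scale0r.
Qed.

Section Universal.
Variables (N : lmodType F) (rho : cartan -> field_op N) (w : L -> N).
Hypotheses (rep : heis_rep rho) (hw : forall a, heis_hw rho (lat_inj F a) (w a)).

Let up (x : creator) : N -> N := rho (delta_mx 0 x.1) (Negz x.2).

Let upC x y v : up x (up y v) = up y (up x v).
Proof.
case: rep => _ _ /(_ _ _ _ _ v) c; apply/eqP; rewrite -subr_eq0 /up c.
by rewrite mulr0 mul0r scale0r.
Qed.

Let word (a : L) (s : seq creator) : N := foldr up (w a) s.

Let word_rem a x s : x \in s -> word a s = up x (word a (rem x s)).
Proof.
elim: s => [//|y s IH]; rewrite inE /=; case: (eqVneq y x) => [-> //|yx] /=.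
by move/IH=> ->; rewrite upC.
Qed.

Let word_perm a s t : perm_eq s t -> word a s = word a t.
Proof.
elim: s t => [|x s IH] t; first by rewrite perm_sym => /perm_nilP ->.
move=> st; have xt : x \in t by rewrite -(perm_mem st) mem_head.
rewrite (word_rem a xt) /= (IH (rem x t))// -(perm_cons x).
exact: perm_trans st (perm_to_rem xt).
Qed.

Let rho_linear h n : linear (rho h n). Proof. by case: rep. Qed.

Let rho_word0 h a s : rho h 0 (word a s) = cartan_form h (lat_inj F a) *: word a s.
Proof.
elim: s => [|x s IH] /=; first by case: (hw a).
case: rep => _ _ /(_ h (delta_mx 0 x.1) 0 (Negz x.2) (word a s)) /eqP.
rewrite !mul0r scale0r subr_eq0 => /eqP e; rewrite [LHS]e IH.
exact: (lin_Z _ _ (rho_linear _ _)).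
Qed.

Let rho_word_pos h n a s : rho h n.+1%:Z (word a s) =
  \sum_i ((count_mem ((i, n) : creator) s * n.+1)%:R * cartan_form h (delta_mx 0 i)) *:
     word a (rem ((i, n) : creator) s).
Proof.
elim: s => [|[l q] s IH].
  case: (hw a) => _ e; rewrite [LHS]e big1// => i _.
  by rewrite mul0n mul0r scale0r.
case: rep => _ _ /(_ h (delta_mx 0 l) n.+1 (Negz q) (word a s)) /eqP.
rewrite subr_eq => /eqP e; rewrite [LHS]e IH addrC.
rewrite (lin_sum1 (e := fun=> 1) _ (rho_linear (delta_mx 0 l) (Negz q))
  (w' := fun i => up (l, q) (word a (rem ((i, n) : creator) s)))); last first.
  by move=> i; rewrite scale1r.
have -> : (n.+1%:Z%:~R * (n.+1%:Z + Negz q == 0)%:R *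
    cartan_form h (delta_mx 0 l)) *: word a s =
  \sum_i (((l, q) == ((i, n) : creator))%:R * n.+1%:R * cartan_form h (delta_mx 0 i)) *: word a s.
  rewrite (sum_single (j := l)); last first.
    by move=> i il; rewrite xpair_eqE eq_sym (negPf il) !mul0r scale0r.
  congr (_ *: _); rewrite xpair_eqE eqxx NegzE subr_eq0 eqz_nat eqSS eq_sym.
  by rewrite [n.+1%:Z%:~R * _]mulrC.
rewrite -big_split; apply: eq_bigr => i _ /=.
case: (eqVneq (l, q) (i, n)) => [->|_]; last first.
  by rewrite add0n !mul0r scale0r addr0 mulr1.
rewrite mulr1 mul1r; have [c0|c0] := posnP (count_mem ((i, n) : creator) s).
  by rewrite c0 mul0n mul0r scale0r add0r addn0 mul1n.
rewrite -word_rem; last by rewrite -has_pred1 has_count.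
by rewrite -scalerDl; congr (_ *: _); rewrite mulnDl natrD mul1n; ring.
Qed.

Let word_mset a m := word a (enum_mset m).

Let word_mset_cons a x m : word_mset a (x +` m)%mset = up x (word_mset a m).
Proof.
rewrite -[RHS]/(word a (x :: enum_mset m)); apply: word_perm.
apply/allP => y _ /=; rewrite !count_mem_mset mset1DE.
by rewrite [y == x]eq_sym.
Qed.

Let word_mset_rem a x m :
  word a (rem x (enum_mset m)) = word_mset a (m `\ x)%mset.
Proof.
apply: word_perm; apply/allP => y _ /=.
by rewrite count_mem_rem !count_mem_mset msetB1E [y == x]eq_sym.
Qed.

Let phi : fock -> N := lin_ext (fun k => word_mset k.1 k.2).

Let phi_linear : linear phi. Proof. exact: lin_ext_linear. Qed.

Let phiU a m : phi << (a, m) >> = word_mset a m.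
Proof. exact: lin_extU. Qed.

Definition heis_ext (f : fock -> N) :=
  [/\ linear f, forall h n v, f (heis h n v) = rho h n (f v)
    & forall a, f (evec F a) = w a].

Lemma heis_ext_exists : exists f, heis_ext f.
Proof.
exists phi; split=> //; last first.
  by move=> a; rewrite [LHS]phiU /word_mset enum_mset0.
move=> h n; apply: (fock_lin_eq (lin_comp phi_linear (heis_linear h n))
  (lin_comp (rho_linear h n) phi_linear)) => -[a m]; cbv beta.
rewrite phiU; case: n => [[|n]|n].
- by rewrite [heis _ _ _]zero_U (lin_Z _ _ phi_linear) phiU rho_word0.
- rewrite [heis _ _ _]annihilate_U rho_word_pos.
  rewrite (lin_sum1 (e := fun=> 1) _ phi_linear
    (w' := fun i => word a (rem ((i, n) : creator) (enum_mset m)))).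
    by apply: eq_bigr => i _; rewrite mulr1 count_mem_mset.
  by move=> i; rewrite scale1r phiU word_mset_rem.
- rewrite [heis _ _ _]create_U [in RHS](cartan_decomp h).
  have lr : linear (fun h : cartan => rho h (Negz n) (word_mset a m)) by case: rep.
  rewrite (lin_sum1 (e := fun=> 1) _ phi_linear
    (w' := fun i => up (i, n) (word_mset a m))); last first.
    by move=> i; rewrite scale1r phiU word_mset_cons.
  by rewrite (lin_sum1 (e := fun=> 1) _ lr
    (w' := fun i => up (i, n) (word_mset a m)))// => i; rewrite scale1r.
Qed.

Lemma heis_ext_unique (f g : fock -> N) : heis_ext f -> heis_ext g -> f =1 g.
Proof.
move=> [lf hf ff] [lg hg gf]; have fg a : f (evec F a) = g (evec F a).
  by rewrite ff gf.
apply: fock_lin_eq => // -[a m].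
rewrite -[m]seq_mset_id; elim: (enum_mset m) => [|[i n] s IH].
  have -> : seq_mset ([::] : seq creator) = mset0.
    by apply/msetP => z; rewrite mset_seqE mset0E.
  exact: fg.
have -> : seq_mset ((i, n) :: s) = (((i, n) : creator) +` seq_mset s)%mset.
  by apply/msetP => z; rewrite mset1DE !mset_seqE /= [z == _]eq_sym.
have e : heis (delta_mx 0 i) (Negz n) (<< (a, seq_mset s) >> : fock) =
  << (a, (((i, n) : creator) +` seq_mset s)%mset) >> by exact: create_delta.
by rewrite -e hf hg IH.
Qed.

Lemma fock_universal :
  exists2 f, heis_ext f & forall g, heis_ext g -> g =1 f.
Proof.
have [f fP] := heis_ext_exists; exists f => // g gP.
exact: heis_ext_unique.
Qed.
End Universal.

End InducedModules.

(* Main.v *)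
Require Import Defs.
From mathcomp Require Import all_boot all_order all_algebra.
From mathcomp Require Import finmap multiset monalg.
From mathcomp Require Import boolp classical_sets fsbigop reals complex.

Set Implicit Arguments.
Unset Strict Implicit.
Unset Printing Implicit Defensive.

Import Order.TTheory GRing.Theory Num.Theory.
Local Open Scope ring_scope.
Local Open Scope complex_scope.

(** Two independent facts carry the proof.

    Charge.  The Fock space is graded by [L], the vector [b_(i_1)(-n_1-1) ...
    e^a] having charge [a].  The operators [h(m)] preserve the charge and
    [twist a] adds [a] to it; all the modes of vertex operators are sums of
    composites of these, so every product [v_n w] has charge the sum of those
    of [v] and [w] ([fock_sub_lattice_Y]).  Closure of [V_M] and [V_S] under
    the products and the ideal property are therefore statements about sums of
    subsets of [L], and since [omega] has charge [0], [L(-1)] preserves every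
    [V_A].  No convergence argument enters: [lfsum] is a finite sum of values
    of its family, or else the zero vector, which lies in every [V_A].

    Weight.  To see that [V_M] is of CFT-type, [L(0)] is computed from its
    definition as the mode [omega_1].  The field of [e^0] is the identity, so the
    field of [h(-1)h'(-1)e^0] is the normally ordered product of [h(z)] and
    [h'(z)], and its mode [1] is a sum of a zero mode part and of products of a
    creation and an annihilation operator ([create_create_mode1]).  Summing over
    an orthonormal basis gives the Casimir expression of [L(0)], which may be
    rewritten with the basis [b_i] and its dual basis ([casimir], [Vir0E]).  In
    that form each [b_i(-n) b^i(n)] counts, up to the factor [n], the factors
    [b_i(-n)] of a PBW vector, so that [L(0)] is diagonal in the PBW basis with
    eigenvalue [\sum_j (n_j+1) + (a|a)/2] ([L0_U]).  These eigenvalues are natural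
    numbers because the form is even and positive, and vanish only for [e^0].
    Since [V_A] is spanned by PBW vectors, it inherits the decomposition. *)

(** * Linear maps *)

Section LinearMaps.
Variables (F : fieldType) (V W : lmodType F).

Lemma linear_zero (f : V -> W) : linear f -> f 0 = 0.
Proof. by move=> lf; rewrite -[0 in LHS](scale0r 0) (lin_Z _ _ lf) scale0r. Qed.

Lemma linear_big (I : Type) (r : seq I) (f : V -> W) (w : I -> V) :
  linear f -> f (\sum_(i <- r) w i) = \sum_(i <- r) f (w i).
Proof.
move=> lf; elim/big_rec2: _ => [|i x y _ <-]; first exact: linear_zero.
by have := lf 1 (w i) y; rewrite !scale1r.
Qed.

Lemma linear_bigZ (I : Type) (r : seq I) (f : V -> W) (c : I -> F)
    (w : I -> V) :
  linear f -> f (\sum_(i <- r) c i *: w i) = \sum_(i <- r) c i *: f (w i).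
Proof.
move=> lf; rewrite (linear_big _ _ lf); apply: eq_bigr => i _.
by rewrite (lin_Z _ _ lf).
Qed.

Lemma lin_sum (I : finType) (f : I -> V -> W) :
  (forall i, linear (f i)) -> linear (fun v : V => \sum_i f i v).
Proof.
move=> lf c v w; rewrite scaler_sumr -big_split; apply: eq_bigr => i _ /=.
by rewrite lf.
Qed.

End LinearMaps.

(** * Locally finite sums and exponential series *)

Section LocallyFiniteSums.
Variables (F : fieldType) (V : lmodType F).
Implicit Types (f : nat -> V).

Lemma lfsum_ord N f :
  (forall j, (N <= j)%N -> f j = 0) -> lfsum f = \sum_(j < N) f j.
Proof.
move=> f0; rewrite fsbig_ord; apply: esym; apply: fsbig_widen => // j /= [_ /negP].
by rewrite -leqNgt; apply: f0.
Qed.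

Lemma lfsum_single f j : (forall i, i != j -> f i = 0) -> lfsum f = f j.
Proof.
move=> f0; rewrite (@lfsum_ord j.+1) => [|i ji]; last first.
  by apply: f0; rewrite gtn_eqF.
rewrite big_ord_recr big1 /= => [|i _]; first exact: add0r.
by apply: f0; rewrite ltn_eqF.
Qed.

Lemma lfsum0 f : (forall i, f i = 0) -> lfsum f = 0.
Proof. by move=> f0; rewrite (@lfsum_single _ 0%N). Qed.

Lemma opseries_exp0 (f : opseries V) n v :
  (forall m w, f m w = 0) -> opseries_exp f n v = opseries1 n v.
Proof.
move=> f0; rewrite /opseries_exp big_ord_recl big1 /= => [|i _].
  by rewrite addr0 invr1 scale1r.
by rewrite /opseries_mul big1 ?scaler0.
Qed.

End LocallyFiniteSums.

(** For the enumeration, in an unspecified order, of a multiset with two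
    elements. *)
Lemma perm_eq_pair (T : eqType) (s : seq T) (x y : T) :
  perm_eq s [:: x; y] -> s = [:: x; y] \/ s = [:: y; x].
Proof.
have perm1 (a b : T) : perm_eq [:: a] [:: b] -> [:: a] = [:: b].
  by move=> ab; apply: perm_small_eq.
move=> sxy; have := perm_size sxy; case: s sxy => [|a [|b []]] //= sxy _.
have : a \in [:: x; y] by rewrite -(perm_mem sxy) mem_head.
rewrite !inE => /orP[] /eqP ax; move: sxy; rewrite {}ax.
  by rewrite perm_cons => /perm1 ->; left.
rewrite (permPr (permEl (perm_catC [:: x] [:: y]))) perm_cons => /perm1 ->.
by right.
Qed.

(** * Charge *)

Section Charge.
Variables (F : fieldType) (L : evenLattice).
Implicit Types (A B C : set L) (a b : L) (v w : fock F L).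
Local Notation fock := (fock F L).

Lemma fock_subP A v :
  fock_sub A v <-> forall k, v@_k != 0 -> A k.1.
Proof. by split=> Av k; [rewrite mcoeff_neq0|rewrite -mcoeff_neq0]; apply: Av. Qed.

Lemma fock_sub0 A : fock_sub A (0 : fock).
Proof. by apply/fock_subP => k; rewrite mcoeff0 eqxx. Qed.

Lemma fock_subD A v w : fock_sub A v -> fock_sub A w -> fock_sub A (v + w).
Proof.
move=> /fock_subP Av /fock_subP Aw; apply/fock_subP => k; rewrite mcoeffD.
have [->|/Av //] := eqVneq v@_k 0; rewrite add0r; exact: Aw.
Qed.

Lemma fock_subZ A c v : fock_sub A v -> fock_sub A (c *: v).
Proof.
move=> /fock_subP Av; apply/fock_subP => k.
by rewrite mcoeffZ mulf_eq0 negb_or => /andP[_ /Av].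
Qed.

Lemma fock_sub_sum A (I : Type) (r : seq I) (P : pred I) (f : I -> fock) :
  (forall i, P i -> fock_sub A (f i)) -> fock_sub A (\sum_(i <- r | P i) f i).
Proof.
move=> Af; apply: (big_ind (@fock_sub F L A)) => //; first exact: fock_sub0.
by move=> v w; apply: fock_subD.
Qed.

Lemma fock_sub_lfsum A (f : nat -> fock) :
  (forall j, fock_sub A (f j)) -> fock_sub A (lfsum f).
Proof. by move=> Af; apply: fock_sub_sum. Qed.

Lemma fock_subU A (k : fockIdx L) : A k.1 -> fock_sub A (<< k >> : fock).
Proof.
move=> Ak; apply/fock_subP => k'; rewrite mcoeffU.
by case: (eqVneq k k') => [<- //|_]; rewrite mulr0n eqxx.
Qed.

Lemma fock_sub_lin_ext A C (f : fockIdx L -> fock) v :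
  (forall k, A k.1 -> fock_sub C (f k)) -> fock_sub A v ->
  fock_sub C (lin_ext f v).
Proof.
move=> fC Av; rewrite /lin_ext big_seq_cond; apply: fock_sub_sum => k.
by rewrite andbT => /Av/fC; apply: fock_subZ.
Qed.

(** Heisenberg operators change only the multiset of a PBW index, never its
    lattice element. *)
Lemma fock_sub_heis A h m v : fock_sub A v -> fock_sub A (heis h m v).
Proof.
case: m => [[|n]|n] Av; apply: (fock_sub_lin_ext _ Av) => k Ak /=.
- by apply: fock_subZ; apply: fock_subU.
- by apply: fock_sub_sum => i _; apply: fock_subZ; apply: fock_subU.
- by apply: fock_sub_sum => i _; apply: fock_subZ; apply: fock_subU.
Qed.

Lemma fock_sub_field_dpow A m (B : field_op fock) n v :
  (forall n v, fock_sub A v -> fock_sub A (B n v)) ->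
  fock_sub A v -> fock_sub A (field_dpow m B n v).
Proof.
move=> AB Av; apply: fock_subZ; elim: m n v Av => [|m IH] n v Av /=; first exact: AB.
by apply: fock_subZ; apply: IH.
Qed.

(** The field [E] may shift the charge from [A] to [C], while [D], standing for a
    derivative of [h(z)], preserves it both before and after [E] acts. *)
Lemma fock_sub_nop A C (D E : field_op fock) n v :
  (forall n v, fock_sub A v -> fock_sub A (D n v)) ->
  (forall n v, fock_sub C v -> fock_sub C (D n v)) ->
  (forall n v, fock_sub A v -> fock_sub C (E n v)) ->
  fock_sub A v -> fock_sub C (nop D E n v).
Proof.
move=> DA DC EAC Av; apply: fock_subD; apply: fock_sub_lfsum => j.
  by apply: DC; apply: EAC.
by apply: EAC; apply: DA.
Qed.

Lemma fock_sub_opseries_exp A (f : opseries fock) n v :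
  (forall n v, fock_sub A v -> fock_sub A (f n v)) ->
  fock_sub A v -> fock_sub A (opseries_exp f n v).
Proof.
move=> fA Av; apply: fock_sub_sum => m _; apply: fock_subZ.
move: {m}(nat_of_ord m) => m; elim: m n v Av => [|m IH] n v Av /=.
  by rewrite /opseries1; case: ifP => _ //; apply: fock_sub0.
by apply: fock_sub_sum => i _; apply: fA; apply: IH.
Qed.

Lemma fock_sub_expprod A a p v : fock_sub A v -> fock_sub A (expprod a p v).
Proof.
move=> Av; apply: fock_sub_lfsum => j.
case: (p + j%:Z) => i; last exact: fock_sub0.
apply: fock_sub_opseries_exp => [n w Aw|].
  by case: ifP => _; [exact: fock_sub0 | apply: fock_subZ; apply: fock_sub_heis].
apply: fock_sub_opseries_exp => // n w Aw.
case: ifP => _; first exact: fock_sub0.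
by rewrite -scaleNr; apply: fock_subZ; apply: fock_sub_heis.
Qed.

Variable eps : L -> L -> int.

(** The shift of charge by [a] comes from [twist a] alone, the exponentials being
    made of Heisenberg operators. *)
Lemma fock_sub_Yexp A C a n v :
  (forall b, A b -> C (a + b)) -> fock_sub A v -> fock_sub C (Yexp eps a n v).
Proof.
move=> AC; apply: fock_sub_lin_ext => k Ak; apply: fock_sub_expprod.
by rewrite /twist lin_extU; apply: fock_subZ; apply: fock_subU; apply: AC.
Qed.

Lemma fock_sub_Ybasis A C k n v :
  (forall b, A b -> C (k.1 + b)) -> fock_sub A v -> fock_sub C (Ybasis eps k n v).
Proof.
move=> AC; rewrite /Ybasis; elim: (enum_mset k.2) n v => [|x s IH] n v /=.
  exact: fock_sub_Yexp.
apply: fock_sub_nop => // {}n {}v; apply: fock_sub_field_dpow => {}n {}v;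
exact: fock_sub_heis.
Qed.

(** Stated for three subsets so that it applies to products inside a submonoid,
    to both sides of an ideal, and, with [A] the singleton of [0], to [L(-1)]. *)
Lemma fock_sub_lattice_Y A B C v w n :
  (forall a b, A a -> B b -> C (a + b)) ->
  fock_sub A v -> fock_sub B w -> fock_sub C (lattice_Y eps v n w).
Proof.
move=> ABC Av Bw; apply: (fock_sub_lin_ext _ Av) => k Ak /=.
by apply: (@fock_sub_Ybasis B) => // b; apply: ABC.
Qed.

Variable u : 'I_(lat_rank L) -> cartan F L.

Lemma fock_sub_subspace A : @subspace F (latticeVOA eps u) (fock_sub A).
Proof.
split=> [|c v w Av Aw]; first exact: fock_sub0.
by apply: fock_subD => //; apply: fock_subZ.
Qed.

Lemma fock_sub_omega A :
  A 0 -> fock_sub A (lattice_omega u).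
Proof.
move=> A0; apply: fock_subZ; apply: fock_sub_sum => l _.
by do 2!apply: fock_sub_heis; apply: fock_subU.
Qed.

End Charge.

(** * The lattice form *)

Section LatticeForm.
Variables (F : fieldType) (L : evenLattice).
Implicit Types (a b : L).

Lemma lat_form0 b : lat_form 0 b = 0.
Proof. by apply: (addrI (lat_form 0 b)); rewrite -lat_formD !addr0. Qed.

Lemma lat_formMz a b (x : int) : lat_form (a *~ x) b = x * lat_form a b.
Proof.
have fN c : lat_form (- c) b = - lat_form c b.
  by apply/eqP; rewrite -addr_eq0 -lat_formD addNr lat_form0.
have fn n : lat_form (a *+ n) b = n%:Z * lat_form a b.
  elim: n => [|n IH]; first by rewrite mulr0n lat_form0 mul0r.
  by rewrite mulrS lat_formD IH -add1n PoszD mulrDl mul1r.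
by case: x => n; rewrite ?NegzE ?mulrNz ?fN -pmulrn fn ?mulNr.
Qed.

Lemma lat_form_sum (I : Type) (r : seq I) (f : I -> L) b :
  lat_form (\sum_(i <- r) f i) b = \sum_(i <- r) lat_form (f i) b.
Proof.
by elim/big_rec2: _ => [|i x y _ <-]; rewrite ?lat_form0 ?lat_formD.
Qed.

(** Evenness and positivity together make [(a|a)/2] a natural number, the
    weight of [e^a]. *)
Lemma lat_form_half a : lat_form a a = 2 * `|(lat_form a a %/ 2)%Z|%N%:Z.
Proof.
have a0 : 0 <= lat_form a a.
  by have [->|/lat_form_gt0/ltW //] := eqVneq a 0; rewrite lat_form0.
by rewrite gez0_abs ?divz_ge0 // mulrC divzK ?lat_form_even.
Qed.

Lemma lat_coordK a : a = \sum_i lat_basis i *~ lat_coord a i.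
Proof. by apply/lat_basisP. Qed.

Lemma lat_inj0 : lat_inj F (0 : L) = 0.
Proof.
apply/rowP => i; rewrite !mxE.
have /lat_basisP -> : (0 : L) = \sum_i lat_basis i *~ 0 by rewrite big1.
by [].
Qed.

Lemma cartan_form_inj a b :
  cartan_form (lat_inj F a) (lat_inj F b) = (lat_form a b)%:~R.
Proof.
rewrite [in RHS](lat_coordK a) lat_form_sum /cartan_form rmorph_sum /=.
apply: eq_bigr => i _; rewrite lat_formMz lat_formC [in RHS](lat_coordK b).
rewrite lat_form_sum mulr_sumr rmorph_sum /=; apply: eq_bigr => j _.
by rewrite !mxE lat_formMz lat_formC !rmorphM /= mulrA.
Qed.

End LatticeForm.

(** * Bilinear expressions in the Heisenberg operators *)

Section Bilinear.
Variables (F : fieldType) (L : evenLattice).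
Local Notation d := (lat_rank L).
Local Notation cartan := (cartan F L).
Local Notation e_ i := (delta_mx 0 i : cartan).
Implicit Types (v : fock F L) (h : cartan).

Definition bilin (V : lmodType F) (f : cartan -> cartan -> V) :=
  (forall h, linear (f h)) /\ (forall h, linear (f^~ h)).

Lemma linear_coord (V : lmodType F) (f : cartan -> V) h :
  linear f -> f h = \sum_i h 0 i *: f (e_ i).
Proof.
by move=> lf; rewrite [in LHS](cartan_decomp h) (linear_bigZ _ _ _ lf).
Qed.

Lemma eq_bilin (V : lmodType F) (f g : cartan -> cartan -> V) :
  bilin f -> bilin g -> (forall i j, f (e_ i) (e_ j) = g (e_ i) (e_ j)) ->
  forall h h', f h h' = g h h'.
Proof.
move=> [fl fr] [gl gr] fg h h'.
rewrite (linear_coord h (fr h')) (linear_coord h (gr h')).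
apply: eq_bigr => i _; rewrite (linear_coord h' (fl _)) (linear_coord h' (gl _)).
by congr (_ *: _); apply: eq_bigr => j _; rewrite fg.
Qed.

Lemma bilinC (V : lmodType F) (f : cartan -> cartan -> V) :
  bilin f -> bilin (fun h h' => f h' h).
Proof. by case. Qed.

Lemma heis_create_bilin n n' v :
  bilin (fun h h' => heis_create h n (heis_create h' n' v)).
Proof.
split=> h.
  exact: lin_comp (create_linear h n) (heis_linearl (Negz n') v).
exact: (heis_linearl (Negz n)).
Qed.

Lemma heis_zero_bilin v : bilin (fun h h' => heis_zero h (heis_zero h' v)).
Proof.
split=> h.
  exact: lin_comp (zero_linear h) (heis_linearl 0 v).
exact: (heis_linearl 0).
Qed.

Lemma create_annihilate_bilin n v :
  bilin (fun h h' => heis_create h n (heis_annihilate h' n v)).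
Proof.
split=> h.
  exact: lin_comp (create_linear h n) (heis_linearl n.+1%:Z v).
exact: (heis_linearl (Negz n)).
Qed.

End Bilinear.

(** * Depth of a vector *)

Section Depth.
Variables (F : fieldType) (L : evenLattice).
Local Notation fock := (fock F L).
Local Notation creator := (creator L).
Implicit Types (v : fock) (k : fockIdx L).

Lemma fock_basisE v : v = \sum_(k <- msupp v) v@_k *: << k >>.
Proof.
rewrite [LHS]monalgE; apply: eq_bigr => k _.
by apply/malgP => k'; rewrite mcoeffZ !mcoeffU mulrnAr mulr1.
Qed.

(** A PBW vector involves only the [b_i(-n-1)] with [n] below its depth, so that
    [h(n+1)] kills it for all [n] from the depth on: this makes the sums in
    normally ordered products finite. *)
Definition mset_depth (m : {mset creator}%mset) : nat :=
  \max_(x <- enum_mset m) x.2.+1.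

Lemma mset_depthP m i n : (mset_depth m <= n)%N -> m ((i, n) : creator) = 0%N.
Proof.
apply: contraTeq => mx; rewrite -ltnNge /mset_depth.
have xm : ((i, n) : creator) \in enum_mset m by rewrite -mset_neq0.
exact: (@leq_bigmax_seq _ (enum_mset m) xpredT (fun x => x.2.+1) _ xm isT).
Qed.

Definition fock_depth v : nat := \max_(k <- msupp v) mset_depth k.2.

Lemma fock_depthP v k : k \in msupp v -> (mset_depth k.2 <= fock_depth v)%N.
Proof.
move=> kv.
by apply: (@leq_bigmax_seq _ (enum_fset (msupp v)) xpredT (fun k => mset_depth k.2)).
Qed.

Definition annihilated_above (N : nat) v :=
  forall (h : cartan F L) n, (N <= n)%N -> heis_annihilate h n v = 0.

Lemma annihilated_depth v : annihilated_above (fock_depth v) v.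
Proof.
move=> h n vn; rewrite (fock_basisE v) (linear_bigZ _ _ _ (annihilate_linear h n)).
rewrite big_seq big1 // => -[a m] kv; rewrite annihilate_U big1 ?scaler0 // => i _.
rewrite mset_depthP ?mul0n ?mul0r ?scale0r //.
exact: leq_trans (fock_depthP kv) vn.
Qed.

End Depth.

(** * The modes of the vacuum and of the conformal vector *)

Section Conformal.
Variables (F : numFieldType) (L : evenLattice) (eps : L -> L -> int).
Local Notation d := (lat_rank L).
Local Notation fock := (fock F L).
Local Notation fockIdx := (fockIdx L).
Local Notation creator := (creator L).
Local Notation cartan := (cartan F L).
Local Notation e_ i := (delta_mx 0 i : cartan).
Implicit Types (a b : L) (v w : fock) (h : cartan) (k : fockIdx) (x y : creator).

Lemma heis0 m v : heis (0 : cartan) m v = 0.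
Proof.
by have := heis_linearl m v (- 1) 0 0; rewrite scaler0 addr0 scaleN1r addNr.
Qed.

Lemma expplus0 n v : expplus (0 : L) n v = opseries1 n v.
Proof.
apply: opseries_exp0 => m w.
by case: eqP => // _; rewrite lat_inj0 heis0 scaler0 oppr0.
Qed.

Lemma expminus0 n v : expminus (0 : L) n v = opseries1 n v.
Proof.
apply: opseries_exp0 => m w.
by case: eqP => // _; rewrite lat_inj0 heis0 scaler0.
Qed.

(** Both exponentials of [0] are the identity, so only the constant term of
    their product survives. *)
Lemma expprod0 p v : expprod (0 : L) p v = if p == 0 then v else 0.
Proof.
rewrite /expprod (@lfsum_ord _ _ 1) => [|[//|j] _].
  rewrite big_ord1 addr0; case: p => [[|p]|p] //=; rewrite expplus0 expminus0 //.
case: (p + _) => // i; rewrite expplus0 expminus0 /opseries1 /=.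
by case: eqP.
Qed.

Hypothesis heps : lattice_cocycle eps.

(** The vacuum axiom [Y(e^0,z) = 1], in modes. *)
Lemma Yexp0 n v : Yexp eps 0 n v = if n == -1 then v else 0.
Proof.
have -> : Yexp eps 0 n v = lin_ext (fun k => if n == -1 then << k >> else 0) v.
  congr (lin_ext _ v); apply/funext => k /=.
  have [_ _ _ /(_ k.1) [e1 _]] := heps.
  rewrite /twist lin_extU e1 scale1r add0r -surjective_pairing expprod0.
  by rewrite lat_form0 subr0 subr_eq0 eqr_oppLR.
case: eqP => _; last by rewrite /lin_ext big1 // => k _; rewrite scaler0.
by apply: (fock_lin_eq (lin_ext_linear _)) => // k; rewrite lin_extU.
Qed.

(** Against the identity field exactly one mode survives, in the first sum of
    the normally ordered product when [n < 0] and in the second otherwise. *)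
Lemma nop_vacuum (D : field_op fock) n v :
  (forall n, D n 0 = 0) -> nop D (Yexp eps 0) n v = D n v.
Proof.
move=> D0; rewrite /nop; case: n => p.
  rewrite lfsum0 => [|j]; last by rewrite Yexp0 D0.
  rewrite add0r (@lfsum_single F _ _ p) => [|j jp]; first by rewrite Yexp0 subrr.
  by rewrite Yexp0 subr_eq addNr subr_eq0 eqz_nat eq_sym (negPf jp).
rewrite [X in _ + X]lfsum0 => [|j]; last first.
  by rewrite Yexp0 subr_eq addNr subr_eq0.
rewrite addr0 (@lfsum_single F _ _ p) => [|j jp]; rewrite Yexp0 NegzE -addn1 PoszD.
  by rewrite opprD addrAC addNr add0r eqxx.
by rewrite opprD addrAC -subr_eq0 opprK addrNK addrC subr_eq0 eqz_nat (negPf jp) D0.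
Qed.

Lemma field_dpow0 (D : field_op fock) : field_dpow 0 D = D.
Proof. by apply/funext => n; apply/funext => v; rewrite /field_dpow invr1 scale1r. Qed.

(** The coefficient of [z^-2], that is, the mode [1], of [:h(z)h'(z):], on vectors
    killed by all [h(n)] with [n > N]. *)
Definition heis_pair N h h' v :=
  heis_zero h' (heis_zero h v) +
  \sum_(n < N) (heis_create h n (heis_annihilate h' n v) +
                heis_create h' n (heis_annihilate h n v)).

Lemma heis_pairC N h h' v : heis_pair N h h' v = heis_pair N h' h v.
Proof.
rewrite /heis_pair (zero_zero h' h v).
apply: (f_equal (+%R _)); apply: eq_bigr => n _; exact: addrC.
Qed.

Lemma nop_heis N h h' v :
  annihilated_above N v -> nop (heis h) (heis h') 1 v = heis_pair N h h' v.
Proof.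
move=> vN; rewrite /nop (@lfsum_ord _ _ N) => [|j Nj]; last first.
  have -> : heis h' (1 + j%:Z) v = heis_annihilate h' j v by [].
  by rewrite vN // (linear_zero (heis_linear _ _)).
rewrite (@lfsum_ord _ _ N.+1) => [|[//|j] Nj]; last first.
  have -> : heis h j.+1 v = heis_annihilate h j v by [].
  by rewrite vN // (linear_zero (heis_linear _ _)).
rewrite big_ord_recl addrCA; congr (_ + _); rewrite -big_split /=.
apply: eq_bigr => j _; congr (_ + _).
  by rewrite -opprD -PoszD addn1.
by rewrite /bump /= add1n -addrA addrC -addrA addNr addr0.
Qed.

(** The normally ordered product of two fields [b_i(z)] has a symmetric mode [1],
    so the order in which the multiset is enumerated is immaterial. *)
Lemma Ybasis_pair N x y v : annihilated_above N v -> x.2 = 0%N -> y.2 = 0%N ->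
  Ybasis eps (0, (x +` (y +` mset0))%mset) 1 v = heis_pair N (e_ x.1) (e_ y.1) v.
Proof.
move=> vN x0 y0; set m := (x +` _)%mset.
have modes z t : z.2 = 0%N -> t.2 = 0%N ->
    foldr (fun (x : creator) B => nop (field_dpow x.2 (heis (e_ x.1))) B)
      (Yexp eps 0) [:: z; t] 1 v = heis_pair N (e_ z.1) (e_ t.1) v.
  move=> /= -> ->; rewrite -(nop_heis _ _ vN).
  have lin0 n : heis (e_ t.1) n (0 : fock) = 0.
    exact: linear_zero (heis_linear _ _).
  apply: (f_equal (fun D : field_op fock => D 1 v)).
  apply: (f_equal2 (@nop F fock)); rewrite field_dpow0 //.
  by apply/funext => n; apply/funext => w; apply: nop_vacuum.
have : perm_eq (enum_mset m) [:: x; y].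
  apply/allP => z _ /=; rewrite count_mem_mset !mset1DE mset0E.
  by rewrite ![z == _]eq_sym.
rewrite /Ybasis => /perm_eq_pair[] ->; first exact: modes.
by rewrite (heis_pairC N (e_ x.1)); apply: modes.
Qed.

Lemma heis_pair_bilin N v : bilin (fun h h' => heis_pair N h h' v).
Proof.
split=> h; (apply: lin_add; [|apply: lin_sum => n; apply: lin_add]).
- by case: (bilinC (heis_zero_bilin v)).
- by case: (create_annihilate_bilin n v) => /(_ h).
- by case: (create_annihilate_bilin n v) => _ /(_ h).
- by case: (bilinC (heis_zero_bilin v)).
- by case: (create_annihilate_bilin n v) => _ /(_ h).
- by case: (create_annihilate_bilin n v) => /(_ h).
Qed.

Lemma lattice_Y_linear n w : linear (fun v => lattice_Y eps v n w).
Proof. exact: lin_ext_linear. Qed.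

(** Both sides are bilinear in [h] and [h'], and for [b_i] and [b_j] the vector is
    a single PBW basis element, for which [Y] is given by its definition. *)
Lemma create_create_mode1 N h h' v : annihilated_above N v ->
  lattice_Y eps (heis_create h 0 (heis_create h' 0 (evec F 0))) 1 v =
  heis_pair N h h' v.
Proof.
move=> vN; move: h h'; apply: eq_bilin (heis_pair_bilin N v) _.
  have [cl cr] := heis_create_bilin 0 0 (evec F (0 : L)).
  by split=> h; [exact: lin_comp (lattice_Y_linear 1 v) (cl h)
                |exact: lin_comp (lattice_Y_linear 1 v) (cr h)].
move=> i j; rewrite /evec !create_delta /lattice_Y lin_extU.
exact: Ybasis_pair.
Qed.

Section Orthonormal.
Variable u : 'I_d -> cartan.
Hypothesis hu : orthonormal_basis u.

(** The basis dual to the [b_i], see [dualP]. *)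
Definition dual i : cartan := \sum_l u l 0 i *: u l.

(** The Casimir tensor of the form is the same for the orthonormal basis and for
    a pair of dual bases. *)
Lemma casimir (V : lmodType F) (f : cartan -> cartan -> V) :
  bilin f -> \sum_l f (u l) (u l) = \sum_i f (e_ i) (dual i).
Proof.
move=> [fl fr]; under eq_bigr do rewrite (linear_coord _ (fr _)).
rewrite exchange_big; apply: eq_bigr => i _.
by rewrite (linear_bigZ _ _ _ (fl _)).
Qed.

(** With [U] the matrix of the [u_l] and [B] the Gram matrix of the [b_i],
    orthonormality says [U B U^T = 1]; hence [U^T U] inverts [B]. *)
Lemma dualP i j : cartan_form (dual i) (e_ j) = (i == j)%:R.
Proof.
pose U := \matrix_(l, p) u l 0 p.
pose B := \matrix_(p, q) cartan_form (e_ p) (e_ q).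
have lform h : linear (fun k : cartan => cartan_form k h : F^o).
  by move=> c h1 h2; exact: cartan_formDl.
have UB l q : (U *m B) l q = cartan_form (u l) (e_ q).
  rewrite (linear_coord (u l) (lform _)) mxE.
  by apply: eq_bigr => p _; rewrite !mxE.
have UBU : U *m (B *m U^T) = 1%:M.
  rewrite mulmxA; apply/matrixP => l l'; rewrite mxE [RHS]mxE -hu.
  rewrite [RHS]cartan_form_basis; apply: eq_bigr => q _.
  by rewrite UB !mxE mulrC.
have /mulmx1C : B *m (U^T *m U) = 1%:M by rewrite mulmxA; apply: mulmx1C.
rewrite -mulmxA => /matrixP /(_ i j); rewrite [RHS]mxE => <-.
rewrite (linear_bigZ _ _ _ (lform _)) mxE; apply: eq_bigr => l _.
by rewrite UB !mxE.
Qed.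

(** The Sugawara expression of [L(0)] in dual bases, truncated at [N]. *)
Definition L0 N v :=
  2%:R^-1 *: (\sum_i heis_zero (e_ i) (heis_zero (dual i) v)) +
  \sum_(n < N) \sum_i heis_create (e_ i) n (heis_annihilate (dual i) n v).

Lemma L0_linear N : linear (L0 N).
Proof.
apply: lin_add.
  apply: lin_comp (@lin_scale _ _ _) _; apply: (@lin_sum F) => i.
  exact: lin_comp (zero_linear (e_ i)) (zero_linear (dual i)).
apply: (@lin_sum F) => n; apply: (@lin_sum F) => i.
exact: lin_comp (create_linear (e_ i) n) (annihilate_linear (dual i) n).
Qed.

Lemma heis_pair_diag N h v :
  heis_pair N h h v = heis_zero h (heis_zero h v) +
    2%:R *: \sum_(n < N) heis_create h n (heis_annihilate h n v).
Proof.
apply: (f_equal (+%R _)); rewrite scaler_sumr; apply: eq_bigr => n _.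
by rewrite scaler_nat mulr2n.
Qed.

(** [omega] is a combination of the vectors of [create_create_mode1]; in the diagonal
    case [h = h'] the two halves of the oscillator part of [heis_pair] coincide,
    which cancels the factor [1/2]. *)
Lemma Vir0E v : @Vir F (latticeVOA eps u) 0 v = L0 (fock_depth v) v.
Proof.
have vN := @annihilated_depth F L v; set N := fock_depth v in vN *.
rewrite -[LHS]/(lattice_Y eps (lattice_omega u) 1 v) /lattice_omega.
rewrite (lin_Z _ _ (lattice_Y_linear 1 v)) (linear_big _ _ (lattice_Y_linear 1 v)).
rewrite (eq_bigr (fun l => heis_zero (u l) (heis_zero (u l) v) +
    2%:R *: \sum_(n < N) heis_create (u l) n (heis_annihilate (u l) n v))); last first.
  by move=> l _; rewrite -heis_pair_diag -(create_create_mode1 _ _ vN).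
rewrite big_split -scaler_sumr scalerDr scalerA mulVf ?pnatr_eq0 // scale1r.
rewrite (casimir (heis_zero_bilin v)) exchange_big /=.
apply: (f_equal (+%R _)); apply: eq_bigr => n _.
exact: (casimir (create_annihilate_bilin n v)).
Qed.

(** The sum of the [n_j + 1] over the factors [b_(i_j)(-n_j-1)], grouped by the
    values of [n_j] and [i_j] so as to match [L0]. *)
Definition oscillator_weight (m : {mset creator}%mset) : nat :=
  \sum_(n < mset_depth m) \sum_i m ((i, n : nat) : creator) * n.+1.

Definition fock_weight k : nat :=
  (`|(lat_form k.1 k.1 %/ 2)%Z|%N + oscillator_weight k.2)%N.

Lemma oscillator_weightE N m : (mset_depth m <= N)%N ->
  oscillator_weight m = (\sum_(n < N) \sum_i m ((i, n : nat) : creator) * n.+1)%N.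
Proof.
move=> mN; rewrite /oscillator_weight.
rewrite (big_ord_widen _ (fun n => \sum_i m ((i, n) : creator) * n.+1)%N mN).
rewrite big_mkcond; apply: eq_bigr => n _; case: ltnP => // mn.
by rewrite big1 // => i _; rewrite mset_depthP.
Qed.

(** The zero modes contribute [\sum_i (b^i|a)(b_i|a) = (a|a)], since [(b^i|a)] is the
    [i]-th coordinate of [a].  In the oscillator part, [b^i(n+1)] removes a factor
    [b_i(-n-1)], with coefficient [n+1] times its multiplicity, and [b_i(-n-1)]
    puts it back. *)
Lemma L0_U N a m : (mset_depth m <= N)%N ->
  L0 N << (a, m) >> = (fock_weight (a, m))%:R *: << (a, m) >>.
Proof.
move=> mN; rewrite /fock_weight (oscillator_weightE mN) natrD scalerDl /L0.
apply: (f_equal2 +%R).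
  rewrite (eq_bigr (fun i =>
    (lat_inj F a 0 i * cartan_form (lat_inj F a) (e_ i)) *: << (a, m) >>)).
    rewrite -scaler_suml -cartan_form_basis cartan_form_inj scalerA.
    apply: (f_equal ( *:%R^~ _)).
    by rewrite [in LHS]lat_form_half intrM mulKf // pnatr_eq0.
  move=> i _; rewrite zero_U (lin_Z _ _ (zero_linear _)) zero_U scalerA.
  rewrite [cartan_form (e_ i) _]cartan_formC.
  apply: (f_equal (fun c => (c * _) *: _)).
  rewrite cartan_form_basis (bigD1 i) //= dualP eqxx mulr1 big1 ?addr0 // => j ji.
  by rewrite dualP eq_sym (negPf ji) mulr0.
rewrite natr_sum scaler_suml; apply: eq_bigr => n _.
rewrite natr_sum scaler_suml; apply: eq_bigr => i _.
rewrite annihilate_U (sum_single (j := i)) => [|j ji]; last first.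
  by rewrite dualP eq_sym (negPf ji) mulr0 scale0r.
rewrite dualP eqxx mulr1 (lin_Z _ _ (create_linear _ _)) create_delta.
have [m0|mi] := posnP (m ((i, n : nat) : creator)).
  by rewrite m0 mul0n; exact: etrans (scale0r _) (esym (scale0r _)).
by rewrite msetB1K -?mset_gt0.
Qed.

Lemma mcoeff_diag (c : fockIdx -> F) v k :
  (lin_ext (fun k => c k *: << k >>) v : fock)@_k = c k * v@_k.
Proof.
rewrite [in RHS](fock_basisE v) !raddf_sum mulr_sumr; apply: eq_bigr => k' _ /=.
rewrite !mcoeffZ mcoeffU.
by case: eqVneq => [->|_]; rewrite ?mulr0n ?mulr0 // mulr1 mulrC mulr1.
Qed.

Lemma mcoeff_Vir0 v k :
  (@Vir F (latticeVOA eps u) 0 v : fock)@_k = (fock_weight k)%:R * v@_k.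
Proof.
rewrite -(mcoeff_diag (fun k => (fock_weight k)%:R)) Vir0E.
rewrite [X in L0 _ X]fock_basisE (linear_bigZ _ _ _ (L0_linear _)).
apply: (f_equal (mcoeff k)); rewrite /lin_ext big_seq [RHS]big_seq.
apply: eq_bigr => -[a m] kv; apply: (f_equal ( *:%R _)).
exact: L0_U (fock_depthP kv).
Qed.

Lemma fock_weight_eq0 k : (fock_weight k == 0%N) = (k == (0, mset0)).
Proof.
apply/idP/eqP => [|->]; last first.
  rewrite /fock_weight lat_form0 div0z /oscillator_weight /mset_depth.
  by rewrite enum_mset0 big_nil big_ord0.
case: k => a m; rewrite addn_eq0 => /andP[a0 m0].
have -> : a = 0.
  apply/eqP; apply: contraT => /lat_form_gt0.
  by rewrite lat_form_half (eqP a0) mulr0 ltxx.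
congr (_, _); apply/msetP => -[i n]; rewrite mset0E.
have [mn|mn] := leqP (mset_depth m) n; first exact: mset_depthP.
move: m0; rewrite sum_nat_eq0 => /forallP /(_ (Ordinal mn)) /=.
by rewrite sum_nat_eq0 => /forallP /(_ i) /=; rewrite muln_eq0 orbF => /eqP.
Qed.

Local Notation VL := (latticeVOA eps u).

(** A diagonal operator has as eigenvectors exactly the vectors supported on
    basis elements of that eigenvalue; the characteristic being [0], distinct
    natural weights stay distinct in [F]. *)
Lemma fock_weight_spaceP A (n : nat) v :
  @weight_space F VL (fock_sub A) n v <->
  forall k, v@_k != 0 -> A k.1 /\ fock_weight k = n.
Proof.
split=> [[/fock_subP Av /malgP wv] k vk|wv].
  split; first exact: Av.
  have := wv k; rewrite mcoeff_Vir0 mcoeffZ => /(mulIf vk) /eqP.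
  by rewrite -pmulrn eqr_nat => /eqP.
split; first by apply/fock_subP => k /wv[].
apply/malgP => k; rewrite mcoeff_Vir0 mcoeffZ.
by have [->|/wv[_ ->]] := eqVneq v@_k 0; rewrite ?mulr0.
Qed.

(** [L(0)] acts on coefficients, as does the condition defining [fock_sub A], so
    the homogeneous components of a vector are its restrictions to the PBW basis
    elements of each weight, and vectors of distinct weights have disjoint
    supports. *)
Lemma fock_sub_CFT_type A : A 0 -> @CFT_type F VL (fock_sub A).
Proof.
move=> A0; split.
- move=> v /fock_subP Av.
  pose x n : fock := lin_ext (fun k => (fock_weight k == n)%:R *: << k >>) v.
  pose N := (\max_(k <- msupp v) fock_weight k).+1.
  exists N, x; split=> [n|].
    apply/fock_weight_spaceP => k; rewrite mcoeff_diag.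
    have [wk|_] := eqVneq (fock_weight k) n; last by rewrite mul0r eqxx.
    by rewrite mul1r => /Av.
  apply/malgP => k; rewrite raddf_sum /=.
  have [vk|vk] := eqVneq v@_k 0.
    by rewrite vk big1 // => n _; rewrite mcoeff_diag vk mulr0.
  have kN : (fock_weight k < N)%N.
    by apply: (@leq_bigmax_seq _ (enum_fset (msupp v)) xpredT fock_weight);
       rewrite -?mcoeff_neq0.
  rewrite (sum_single (j := Ordinal kN)) => [|n nk].
    by rewrite mcoeff_diag eqxx mul1r.
  by rewrite mcoeff_diag (_ : _ == _ = false) ?mul0r // eq_sym -[RHS](negPf nk).
- move=> N x xW x0 n; apply/malgP => k; rewrite mcoeff0.
  apply/eqP; apply: contraT => xk.
  have [_ wk] := (fock_weight_spaceP A n (x n)).1 (xW n) k xk.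
  have /eqP : (\sum_(n < N) x n : fock)@_k = 0 by rewrite [X in X@_k]x0 mcoeff0.
  rewrite raddf_sum (sum_single (j := n)) ?(negPf xk) // => n' n'n /=.
  apply/eqP; apply: contraNT n'n => xk'; apply/eqP/val_inj.
  by have [_ wk'] := (fock_weight_spaceP A n' (x n')).1 (xW n') k xk';
     exact: etrans (esym wk') wk.
- move=> v; split=> [/(fock_weight_spaceP A 0%N) wv|[c ->]].
    exists v@_(0, mset0); apply/malgP => k; rewrite mcoeffZ mcoeffU.
    have [<-|k0] := eqVneq (0, mset0) k; first by rewrite mulr1.
    rewrite mulr0n mulr0; apply/eqP; apply: contraT => /wv[_ /eqP].
    by rewrite fock_weight_eq0 eq_sym (negPf k0).
  apply/(fock_weight_spaceP A 0%N) => k; rewrite mcoeffZ mcoeffU.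
  have [<- _|_] := eqVneq (0, mset0) k; last by rewrite mulr0n mulr0 eqxx.
  by split=> //; apply/eqP; rewrite fock_weight_eq0.
Qed.

End Orthonormal.
End Conformal.

Theorem proposition3p2 (R : realType) (L : evenLattice) (eps : L -> L -> int)
  (heps : lattice_cocycle eps)
  (u : 'I_(lat_rank L) -> cartan R[i] L) (hu : orthonormal_basis u)
  (M S : set L) (hM : submonoid M) (hS : subsemigroup S) :
  let VL := latticeVOA eps u in
  let V (A : set L) : set VL := fock_sub A in
  (subVOA (V M) /\ CFT_type (V M)) /\
  (subVA_without_vacuum (V S) /\
   ((S `<=` M)%classic -> (forall m s, M m -> S s -> S (m + s)) ->
    ideal_of (V M) (V S))).
Proof.
move=> VL V; have [M0 MD] := hM.
(* [L(-1)] is the mode [omega_0], and [omega] has charge [0]. *)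
have Vir_closed A : forall v : VL, V A v -> V A (Vir (- 1) v).
  move=> v; apply: (@fock_sub_lattice_Y _ _ _ [set 0]%classic A).
    by move=> _ b -> Ab; rewrite add0r.
  exact: fock_sub_omega.
split; split.
- split.
  + exact: fock_sub_subspace.
  + by move=> a b n Ma Mb; apply: fock_sub_lattice_Y Ma Mb.
  + exact: fock_subU.
  + exact: fock_sub_omega.
- exact: fock_sub_CFT_type.
- split; [exact: fock_sub_subspace| |exact: Vir_closed].
  by move=> a b n Sa Sb; apply: fock_sub_lattice_Y Sa Sb.
move=> SM MS; split.
- exact: fock_sub_subspace.
- by move=> v Sv k /Sv/SM.
- move=> a b n Ma Sb; split; first exact: fock_sub_lattice_Y Ma Sb.
  by apply: fock_sub_lattice_Y Sb Ma => s m Ss Mm; rewrite addrC; apply: MS.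
- exact: Vir_closed.
Qed.
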